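(* Let $(j_n)_{n\in\mathbb N}$ be a strictly increasing sequence of positive integers such that $j_n\to\infty$ and $$\frac{\log j_{n+1}}{\log j_n}\longrightarrow 1\qquad (n\to\infty).$$ Let $P\in\mathbb Z[t]$ with $\deg P\geq2$ and let $0<c<1$. Then the family $\{A_{j_n}^{P,c}\}_{n}$ has the strong sweeping-out property for every aperiodic transformation $T$ of a non-atomic standard probability space $(X,\mathcal B,\mu)$. That is, for every $\delta>0$ there is a set $E\in\mathcal B$ with $0<\mu(E)<\delta$ such that $$\limsup_{n\to\infty}A_{j_n}^{P,c}\mathbf 1_E=1\qquad\text{and}\qquad \liminf_{n\to\infty}A_{j_n}^{P,c}\mathbf 1_E=0$$ $\mu$-almost everywhere.
   Context: Transformations $T:X\to X$ are invertible, bi-measurable and measure-preserving; $T$ is aperiodic if its set of periodic points has measure zero. For $N\in\mathbb N=\{1,2,\dots\}$, $$A_N^{P,c}f(x):=\frac1{\lfloor N^c\rfloor}\sum_{h=1}^{\lfloor N^c\rfloor} f\bigl(T^{P(N+h)}x\bigr).$$ $\mathbf 1_E$ is the indicator function of $E$. *)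

(* Defs.v *)
From HB Require Import structures.
From mathcomp Require Export all_boot all_order all_algebra.
From mathcomp Require Export all_classical all_reals all_analysis.

Set Implicit Arguments.
Unset Strict Implicit.
Unset Printing Implicit Defensive.

Import Order.TTheory GRing.Theory Num.Theory.
Import numFieldNormedType.Exports.

Local Open Scope classical_set_scope.
Local Open Scope ring_scope.

Definition borel_set (Y : topologicalType) : set (set Y) := <<s open >>.

(* [mu] is isomorphic mod 0, by [f] restricted to the conull set [X0], to a
   probability on a Borel subset of the Polish space [Y]. The last clause lets
   the sigma-algebra of [X] be anything between the Borel sigma-algebra and its
   completion, so that both conventions for standard spaces (standard Borel
   spaces, complete Lebesgue-Rokhlin spaces) are covered; applied to
   complements it also gives the approximation of [A] from outside. *)
Definition standard_probability (R : realType) (d : measure_display)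
    (X : measurableType d) (mu : probability X R) : Prop :=
  exists (Y : completePseudoMetricType R) (X0 : set X) (f : X -> Y),
    [/\ hausdorff_space Y /\ @second_countable Y,
        measurable X0 /\ mu (~` X0) = 0%E,
        {in X0 &, injective f} /\ borel_set (f @` X0),
        (forall B : set Y, borel_set B -> measurable (X0 `&` f @^-1` B)) &
        (forall A : set X, measurable A ->
           exists B : set Y,
             [/\ borel_set B, X0 `&` f @^-1` B `<=` A &
                 mu (A `\` (X0 `&` f @^-1` B)) = 0%E])].

Definition non_atomic (R : realType) (d : measure_display)
    (X : measurableType d) (mu : probability X R) : Prop :=
  forall A : set X, measurable A -> (0 < mu A)%E ->
    exists B : set X,
      [/\ measurable B, B `<=` A, (0 < mu B)%E & (mu B < mu A)%E].

Definition invertible_measure_preserving (R : realType) (d : measure_display)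
    (X : measurableType d) (mu : probability X R) (T Tinv : X -> X) : Prop :=
  [/\ cancel T Tinv, cancel Tinv T,
      measurable_fun setT T, measurable_fun setT Tinv &
      forall A : set X, measurable A -> mu (T @^-1` A) = mu A].

Definition aperiodic (R : realType) (d : measure_display)
    (X : measurableType d) (mu : probability X R) (T : X -> X) : Prop :=
  mu.-negligible [set x | exists2 n : nat, (0 < n)%N & iter n T x = x].

(* [Negz n] stands for the integer [- n.+1]. *)
Definition iterz (X : Type) (T Tinv : X -> X) (k : int) : X -> X :=
  match k with
  | Posz n => iter n T
  | Negz n => iter n.+1 Tinv
  end.

Definition window (R : realType) (c : R) (N : nat) : nat :=
  Num.truncn (N%:R `^ c : R).

Definition poly_average (R : realType) (X : Type) (T Tinv : X -> X)
    (P : {poly int}) (c : R) (N : nat) (f : X -> R) (x : X) : R :=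
  (window c N)%:R^-1 *
  \sum_(1 <= h < (window c N).+1) f (iterz T Tinv P.[(N + h)%:Z] x).

Definition strong_sweeping_out (R : realType) (d : measure_display)
    (X : measurableType d) (mu : probability X R)
    (A : nat -> (X -> R) -> X -> R) : Prop :=
  forall delta : R, 0 < delta ->
    exists E : set X,
      [/\ measurable E, (0 < mu E)%E, (mu E < delta%:E)%E,
          {ae mu, forall x, limn_esup (fun n => (A n \1_E x)%:E) = 1%E} &
          {ae mu, forall x, limn_einf (fun n => (A n \1_E x)%:E) = 0%E}].

(* Main.v *)
(* Since deg P >= 1 and c < 1, the times P(j + 1), ..., P(j + j^c) lie in an interval of length
   O(j^(deg P - 1 + c)), which is much shorter than their distance |P(j)| ~ j^(deg P) to 0. The
   sequence (j_n) is so dense on the logarithmic scale that, for every r, one finds r of its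
   terms N_0 << ... << N_(r-1) with N_(r-1)^(deg P - 1 + c) much smaller than N_0^(deg P). Hence
   some slope b makes b P(N_k + h) nearly independent of h modulo q, for every k, while nested
   intervals make the resulting r points of R / qZ 1/4-dense. So the colouring
   z -> floor(b z) mod q of Z is such that from every z and for every colour, the translate by z
   of one of the r windows has this colour throughout.

   An aperiodic T admits sets B of arbitrarily small measure that meet almost every orbit, and
   z := - (first hitting time of B) increases by 1 along orbits away from B. The least likely
   colour of z then defines a set F of measure at most 1/q which, from every point outside a
   small set, is visited during a whole window. Finally, take such sets F_k whose measures
   decrease fast enough for the later ones not to disturb the windows of the earlier ones, and
   let E consist of the points whose last membership in an F_k has an even index k. *)
Require Import Defs.
From mathcomp Require Import all_boot all_order all_algebra.
From mathcomp Require Import all_classical all_reals all_analysis.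
From mathcomp Require Import ring lra zify.
Set Implicit Arguments.
Unset Strict Implicit.
Unset Printing Implicit Defensive.

Import Order.TTheory GRing.Theory Num.Theory.
Import numFieldNormedType.Exports.

Local Open Scope classical_set_scope.
Local Open Scope ring_scope.

(** * Nested intervals and polynomial growth *)

(** As b runs through [u, v], b * a n sweeps a length of at least 2q, hence all of some
    [t n + q l, t n + q l + 1/4]. The slopes b that land there form an interval of length 1/(4 a n),
    which the next factor a n.+1 >= 8 q a n stretches to length at least 2q again. *)
Lemma nested_intervals (R : archiRealFieldType) (q bmax : R) (a t : nat -> R) :
    1 <= q -> 2 * q <= a 0 * bmax -> 0 < a 0 ->
    (forall k, 8 * q * a k <= a k.+1) ->
  forall n, exists u v : R, [/\ 0 <= u, u <= v, v <= bmax, 2 * q <= a n * (v - u) &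
    forall b, u <= b -> b <= v -> forall k, (k < n)%N ->
      exists l : int, t k + q * l%:~R <= b * a k <= t k + q * l%:~R + 4^-1].
Proof.
move=> q1 a0b a00 lac; have apos k : 0 < a k.
  by elim: k => // k IH; apply: lt_le_trans (lac k); rewrite !mulr_gt0//; lra.
elim=> [|n [u [v [u0 uv vb qa H]]]].
  by exists 0, bmax; split; rewrite ?subr0//; nra.
have q0 : 0 < q by lra.
(* The first point of t n + qZ at or after u * a n; it exceeds u * a n by at most q, and q + 1/4 <=
   2q because 1 <= q. *)
pose l := Num.ceil ((u * a n - t n) / q).
have [l1 l2] : (u * a n - t n) / q <= l%:~R /\ l%:~R <= (u * a n - t n) / q + 1.
  have /andP[+ ->] := ceil_itv ((u * a n - t n) / q).
  by rewrite rmorphB/= ltrBlDr => /ltW.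
have an := apos n; have an1 := lac n.
rewrite ler_pdivrMr// in l1.
have {}l2 : l%:~R * q <= (u * a n - t n) + q.
  have -> : u * a n - t n + q = ((u * a n - t n) / q + 1) * q by field; lra.
  by rewrite ler_pM2r.
pose w := (t n + q * l%:~R) / a n.
have wE : w * a n = t n + q * l%:~R by rewrite /w divfK// gt_eqF.
have w'E : (w + 4^-1 / a n) * a n = t n + q * l%:~R + 4^-1.
  by rewrite mulrDl wE divfK// gt_eqF.
have uw : u <= w by rewrite -(ler_pM2r an) wE; lra.
have wv : w + 4^-1 / a n <= v by rewrite -(ler_pM2r an) w'E; lra.
have i0 : 0 < 4^-1 / a n by rewrite divr_gt0.
exists w, (w + 4^-1 / a n); split; try lra.
  rewrite addrC addKr mulrCA ler_pdivlMl//; try lra.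
  rewrite ler_pdivlMr//; lra.
move=> b wb bw k; rewrite ltnS leq_eqVlt => /orP[/eqP->|kn]; last first.
  by apply: H => //; lra.
by exists l; rewrite -w'E -wE !ler_pM2r//; exact/andP.
Qed.

(** For a monomial, (x + h)^i - x^i factors as h times i products of degree i - 1 in x + h <= 2x and
    x. *)
Lemma poly_increment (R : realFieldType) (p : {poly R}) (e : nat) :
    ((size p).-1 <= e.+1)%N ->
  exists2 C : R, 0 < C & forall x h, 1 <= x -> 0 <= h -> h <= x ->
    `|p.[x + h] - p.[x]| <= C * x ^+ e * h.
Proof.
move=> sp.
have mono i : (i <= e.+1)%N -> exists2 C : R, 0 <= C & forall x h, 1 <= x -> 0 <= h ->
    h <= x -> `|(x + h) ^+ i - x ^+ i| <= C * x ^+ e * h.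
  case: i => [_|i ie].
    by exists 0 => // x h _ _ _; rewrite !expr0 subrr normr0 !mul0r.
  exists (2 ^+ i * i.+1%:R); first by rewrite mulr_ge0// exprn_ge0.
  move=> x h x1 h0 hx; rewrite subrXX addrAC subrr add0r normrM (ger0_norm h0).
  rewrite mulrC ler_wpM2r//.
  apply: le_trans (ler_norm_sum _ _ _) _.
  apply: (@le_trans _ _ (\sum_(k < i.+1) 2 ^+ i * x ^+ e)); last first.
    by rewrite sumr_const card_ord mulrAC mulr_natr.
  apply: ler_sum => k _.
  have ki : (k <= i)%N by rewrite -ltnS.
  rewrite ger0_norm; last by rewrite mulr_ge0// exprn_ge0//; lra.
  apply: (@le_trans _ _ ((2 * x) ^+ (i - k) * (2 * x) ^+ k)).
    by rewrite /= ler_pM ?exprn_ge0 ?lerXn2r ?nnegrE//; lra.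
  rewrite -exprD subnK// exprMn ler_wpM2l ?exprn_ge0//.
  exact: ler_weXn2l.
suff : exists2 C : R, 0 <= C & forall x h, 1 <= x -> 0 <= h -> h <= x ->
    `|p.[x + h] - p.[x]| <= C * x ^+ e * h.
  move=> [C C0 H]; exists (C + 1) => [|x h x1 h0 hx]; first by rewrite ltr_wpDl.
  apply: le_trans (H x h x1 h0 hx) _.
  by rewrite !ler_wpM2r ?exprn_ge0//; lra.
(* [choice] wants a constant for every i, so the degree bound moves inside the property. *)
have mono' : forall i : nat, exists C : R, 0 <= C /\ ((i <= e.+1)%N -> forall x h,
    1 <= x -> 0 <= h -> h <= x -> `|(x + h) ^+ i - x ^+ i| <= C * x ^+ e * h).
  move=> i; case: (leqP i e.+1) => ie; last by exists 0.
  by have [C C0 H] := mono i ie; exists C.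
have [C HC] := choice mono'.
exists (\sum_(i < size p) `|p`_i| * C i).
  by apply: sumr_ge0 => i _; rewrite mulr_ge0//; apply: (HC i).1.
move=> x h x1 h0 hx; rewrite !horner_coef -sumrB !mulr_suml.
apply: le_trans (ler_norm_sum _ _ _) _; apply: ler_sum => i _.
rewrite -mulrBr normrM -!mulrA ler_wpM2l// mulrA.
apply: (HC i).2 => //; have := ltn_ord i; lia.
Qed.

(** The lower terms add up to at most S * x^e, which is at most half of x^(e+1) once 2S <= x. One C
    serves both as threshold and as factor. *)
Lemma poly_growth (R : realFieldType) (p : {poly R}) (e : nat) :
    (size p).-1 = e.+1 -> 1 <= lead_coef p ->
  exists2 C : R, 0 < C & forall x, C <= x ->
    x ^+ e.+1 / 2 <= p.[x] <= C * x ^+ e.+1.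
Proof.
move=> sp lp.
have spS : size p = e.+2 by lia.
pose S := \sum_(i < e.+1) `|p`_i|.
have S0 : 0 <= S by apply: sumr_ge0.
have lpE : lead_coef p = p`_e.+1 by rewrite lead_coefE sp.
exists (1 + 2 * S + lead_coef p) => [|x xC]; first lra.
have x1 : 1 <= x by lra.
have xe : 0 < x ^+ e by rewrite exprn_gt0//; lra.
have low : `|\sum_(i < e.+1) p`_i * x ^+ i| <= S * x ^+ e.
  apply: le_trans (ler_norm_sum _ _ _) _; rewrite mulr_suml; apply: ler_sum => i _.
  rewrite normrM ler_wpM2l// ger0_norm ?exprn_ge0//; last lra.
  by apply: ler_weXn2l => //; rewrite -ltnS.
rewrite horner_coef spS big_ord_recr/= -lpE.
move: low; rewrite ler_norml => /andP[low1 low2].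
have -> : x ^+ e.+1 = x * x ^+ e by rewrite exprS.
have h1 : 2 * S * x ^+ e <= x * x ^+ e by rewrite ler_pM2r//; lra.
have h2 : x ^+ e <= x * x ^+ e by rewrite ler_peMl//; lra.
apply/andP; split; nra.
Qed.

(** The first term after x n to reach x n + A has a predecessor of at most x n + A, so it is at most
    rho' * (x n + A). The threshold M absorbs rho' * A into the gap (rho - rho') * x n. *)
Lemma log_dense_step (R : realType) (x : nat -> R) (A rho : R) :
    x n @[n --> \oo] --> +oo -> x n.+1 / x n @[n --> \oo] --> (1 : R) ->
    0 < A -> 1 < rho ->
  \forall n \near \oo, exists m, x n + A <= x m <= rho * x n.
Proof.
move=> xoo xratio A0 rho1.
pose rho' := (1 + rho) / 2.
pose M := 2 * rho' * A / (rho - 1).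
have M0 : 0 < M by rewrite /M divr_gt0 ?mulr_gt0 /rho'//; lra.
have xM : \forall n \near \oo, M <= x n by move/cvgryPge: xoo; apply.
have xr : \forall n \near \oo, x n.+1 / x n <= rho'.
  have r0 : 0 < rho' - 1 by rewrite /rho'; lra.
  move/cvgrPdist_le: xratio => /(_ _ r0); apply: filterS => n.
  by rewrite ler_norml => /andP[+ _]; lra.
have [n0 _ H] : \forall n \near \oo, M <= x n /\ x n.+1 / x n <= rho'.
  by near=> n; split; near: n.
exists n0 => // n /= n0n.
have [n1 _ H1] : \forall m \near \oo, x n + A <= x m by move/cvgryPge: xoo; apply.
have ex : exists m, (n < m)%N && (x n + A <= x m).
  exists (maxn n.+1 n1); rewrite leq_maxl/=; apply: H1 => /=; exact: leq_maxr.
case: (ex_minnP ex) => -[//|m] /andP[nm xm] mmin; exists m.+1; rewrite xm/=.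
have xmA : x m <= x n + A.
  rewrite leNgt; apply/negP => lt_m.
  have := mmin m; rewrite (ltW lt_m) andbT ltnn.
  move: nm; rewrite ltnS leq_eqVlt => /orP[/eqP nm|->]; last by move/(_ isT).
  by move: lt_m; rewrite nm; lra.
have [xnM _] := H n n0n.
have [xmM] := H m (leq_trans n0n nm).
rewrite ler_pdivrMr; last lra.
move=> xmr.
have MA : M * (rho - 1) = 2 * rho' * A by rewrite /M divfK// gt_eqF//; lra.
apply: le_trans xmr _; apply: (@le_trans _ _ (rho' * (x n + A))).
  by rewrite ler_wpM2l// /rho'; lra.
have : M * (rho - 1) <= x n * (rho - 1) by rewrite ler_wpM2r//; lra.
rewrite MA /rho'; lra.
Unshelve. all: by end_near.
Qed.

(** Steps can be iterated only while the index stays at least n0. Since x grows along the iteration,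
    starting above every x k with k <= n0 rules out a fall below n0. *)
Lemma log_dense_subsequence (R : realType) (x : nat -> R) (A rho : R) :
    x n @[n --> \oo] --> +oo -> x n.+1 / x n @[n --> \oo] --> (1 : R) ->
    0 < A -> 1 < rho ->
  \forall n \near \oo, exists s : nat -> nat, s 0%N = n /\
    forall k, x (s k) + A <= x (s k.+1) <= rho * x (s k).
Proof.
move=> xoo xratio A0 rho1.
have [n0 _ H0] := log_dense_step xoo xratio A0 rho1.
have {}xoo : \forall n \near \oo, forall k, (k <= n0)%N -> x k < x n.
  have [n1 _ H1] : \forall n \near \oo, \sum_(k < n0.+1) `|x k| + 1 <= x n.
    by move/cvgryPge: xoo; apply.
  exists n1 => // n /H1 + k kn0; apply: lt_le_trans.
  rewrite ltr_pwDr//; have kn0' : (k < n0.+1)%N by [].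
  rewrite (bigD1 (Ordinal kn0'))//= (le_trans (ler_norm _))// lerDl.
  exact: sumr_ge0.
have [n1 _ H1] := xoo.
have ex n : exists m, (n0 <= n)%N -> x n + A <= x m <= rho * x n.
  case: (leqP n0 n) => nn; last by exists n.
  by have [m Hm] := H0 n nn; exists m.
have [f Hf] := choice ex.
exists (maxn n0 n1) => // n /=; rewrite geq_max => /andP[n0n n1n].
exists (fun k => iter k f n); split => // k; rewrite iterS; apply: (Hf).
suff : (n0 <= iter k f n)%N /\ x n <= x (iter k f n) by case.
elim: k => // k [IH1 IH2]; have /andP[h1 h2] := Hf _ IH1.
have le : x n <= x (iter k.+1 f n) by rewrite iterS; lra.
split => //; rewrite leqNgt; apply/negP => /ltnW/(H1 n n1n).
by rewrite ltNge le.
Qed.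

(** * Colourings of the integers *)

(** Modulo q, the points b * a k are within 1/4 above the grid points k/4, which go once around R /
    qZ. For given z and s some k puts b * (z + a k) in [s + 1/4, s + 3/4) modulo q, and the
    remaining margin of 1/4 absorbs the variation over D k. *)
Lemma nested_colouring (R : archiRealFieldType) (q : nat) (b : R) (a : nat -> int)
    (D : nat -> set int) :
    (0 < q)%N ->
    (forall k, (k < 4 * q)%N -> exists l : int,
       k%:R / 4 + q%:R * l%:~R <= b * (a k)%:~R <= k%:R / 4 + q%:R * l%:~R + 4^-1) ->
    (forall k w, (k < 4 * q)%N -> D k w -> `|b * (w - a k)%:~R| <= 4^-1) ->
  forall (z : int) s, (s < q)%N -> exists2 k, (k < 4 * q)%N & forall w, D k w ->
    (Num.floor (b * (z + w)%:~R) %% q)%Z = s.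
Proof.
move=> q0 Ha HD z s sq.
pose y : R := 4 * (s%:R - b * z%:~R).
(* This gives y + 1 <= k' < y + 2, so b z + k'/4 lies in [s + 1/4, s + 1/2); reducing k' modulo 4q
   moves k'/4 by a multiple of q. *)
pose k' := Num.ceil y + 1.
have q40 : (4 * q)%:Z != 0 by lia.
pose k := `|(k' %% (4 * q))%Z|%N.
have kE : k%:Z = (k' %% (4 * q))%Z by rewrite gez0_abs// modz_ge0.
have kq : (k < 4 * q)%N by rewrite -ltz_nat kE ltz_pmod//; lia.
exists k => // w Dw.
have [l Hl] := Ha k kq; have dw := HD k w kq Dw.
have k'E := divz_eq k' (4 * q)%N; rewrite -kE in k'E.
have {}k'E : (k'%:~R : R) = (k' %/ (4 * q)%N)%Z%:~R * (4 * q%:R) + k%:R.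
  by rewrite {1}k'E rmorphD rmorphM/= -pmulrn natrM.
have /andP[y1 y2] := ceil_itv y.
have {}y1 : k'%:~R < y + 2 :> R by move: y1; rewrite /k' !rmorphD rmorphN/=; lra.
have {}y2 : y + 1 <= k'%:~R :> R by rewrite /k' rmorphD/=; lra.
rewrite k'E /y in y1 y2; set L := (k' %/ _)%Z in y1 y2.
have -> : Num.floor (b * (z + w)%:~R) = (l - L) * q + s.
  apply: floor_def; rewrite !(rmorphD, rmorphM, rmorphN)/= -!pmulrn.
  move: dw; rewrite rmorphB/= ler_norml => /andP[d1 d2]; move: Hl => /andP[l1 l2].
  by apply/andP; split; lra.
by rewrite modzMDl modz_small//; lia.
Qed.

Lemma increasing_ge_id (j : nat -> nat) :
  (forall m n : nat, (m < n)%N -> (j m < j n)%N) -> forall n, (n <= j n)%N.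
Proof. by move=> j_incr; elim=> // n IH; apply: leq_ltn_trans (j_incr _ _ (ltnSn n)). Qed.

Lemma cvgy_ln_natr (R : realType) (j : nat -> nat) : (forall n, (n <= j n)%N) ->
  (ln (j n)%:R : R) @[n --> \oo] --> +oo.
Proof.
move=> j_ge_id; apply/cvgryPge => M; exists (Num.truncn (expR M)).+1 => // n /= Mn.
have eM : expR M <= (j n)%:R.
  apply: le_trans (_ : n%:R <= _); last by rewrite ler_nat.
  have /andP[_ /ltW/le_trans] := truncn_itv (expR_ge0 M); apply.
  by rewrite ler_nat.
by rewrite -(expRK M) ler_ln// posrE ?(lt_le_trans _ eM) ?expR_gt0.
Qed.

Lemma polynomial_colouring_pos (R : realType) (j : nat -> nat) (P : {poly int}) (c : R)
    (q n0 : nat) :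
    (forall m n : nat, (m < n)%N -> (j m < j n)%N) ->
    (ln ((j n.+1)%:R : R) / ln ((j n)%:R : R)) @[n --> \oo] --> (1 : R) ->
    (2 <= (size P).-1)%N -> 0 < c -> c < 1 -> (0 < q)%N -> 1 <= lead_coef P ->
  exists (m : nat) (b : R), forall (z : int) s, (s < q)%N ->
    exists n, [/\ (n0 <= n)%N, (n <= m)%N & forall h, (1 <= h <= window c (j n))%N ->
      (Num.floor (b * (z + P.[(j n + h)%:Z])%:~R) %% q)%Z = s].
Proof.
move=> j_incr j_log degP c0 c1 q0 lP.
have j_ge_id := increasing_ge_id j_incr.
pose x n : R := ln (j n)%:R.
have x_infty : x n @[n --> \oo] --> +oo by apply: cvgy_ln_natr.
pose p : {poly R} := map_poly intr P.
have pE (k : nat) : p.[k%:R] = P.[k%:Z]%:~R by rewrite pmulrn horner_map.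
have sp : size p = size P by rewrite size_map_inj_poly// => ? ? /intr_inj.
have lp : 1 <= lead_coef p.
  rewrite lead_coef_map_inj//; last by move=> ? ? /intr_inj.
  by rewrite (ler_int _ 1).
have [e eE] : exists e, (size p).-1 = e.+1 by exists (size P).-2; rewrite sp; lia.
have [C1 C10 inc] : exists2 C : R, 0 < C & forall x h, 1 <= x -> 0 <= h -> h <= x ->
    `|p.[x + h] - p.[x]| <= C * x ^+ e * h by apply: poly_increment; rewrite eE.
have [C2 C20 gro] := poly_growth eE lp.
pose r := (4 * q)%N.
pose Q : R := q%:R.
have Q1 : 1 <= Q by rewrite ler1n.
have e0 : 0 <= (e%:R : R) by [].
(* Chosen so that N_r <= N_0^theta yields N_r^(e + c) <= N_0^(e + (1 + c)/2), which leaves a factor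
   N_0^((1 - c)/2) below N_0^(e + 1). The ratio [rho] spreads theta over the r steps. *)
pose theta := (e%:R + (1 + c) / 2) / (e%:R + c).
have ec0 : 0 < e%:R + c by lra.
have theta1 : 1 < theta.
  rewrite /theta ltr_pdivlMr// mul1r. lra.
pose rho := expR (ln theta / r%:R).
have r0 : 0 < (r%:R : R) by rewrite ltr0n /r muln_gt0.
have rho1 : 1 < rho by rewrite expR_gt1 divr_gt0// ln_gt0.
have rhor : rho ^+ r = theta.
  by rewrite /rho -expRM_natl mulrC divfK ?gt_eqF// lnK// posrE; lra.
(* Growth of N by the factor L makes the values of P grow by 8Q, as [nested_intervals] requires. *)
pose L := 1 + 16 * Q * C2.
have QC2 : 0 < Q * C2 by apply: mulr_gt0; lra.
have L1 : 1 < L by rewrite /L; lra.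
pose K := 16 * Q * C1.
have K0 : 0 < K by apply: mulr_gt0 => //; lra.
have sel := log_dense_subsequence x_infty j_log (ln_gt0 L1) rho1.
have large : \forall n \near \oo, 2 * ln K / (1 - c) <= x n.
  by have /cvgryPge := x_infty; apply.
have [n1 _ Hn1] : \forall n \near \oo, 2 * ln K / (1 - c) <= x n /\
    exists s : nat -> nat, s 0%N = n /\
      forall k, x (s k) + ln L <= x (s k.+1) <= rho * x (s k).
  by near=> n; split; near: n.
(* Beyond n0 for the conclusion, beyond n1 for the selection, and so large that j n2 >= C2 + 1,
   where the growth bounds for p apply. *)
pose n2 := maxn (maxn n0 n1) (Num.truncn (C2 + 1)).+1.
have [n2K [s [s0 Hs]]] : 2 * ln K / (1 - c) <= x n2 /\ exists s : nat -> nat,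
    s 0%N = n2 /\ forall k, x (s k) + ln L <= x (s k.+1) <= rho * x (s k).
  by apply: Hn1; rewrite /= /n2 !leq_max leqnn orbT.
pose N k : R := (j (s k))%:R.
have xinc k : x (s k) <= x (s k.+1).
  by have /andP[+ _] := Hs k; have := ln_gt0 L1; lra.
have xmon k l : (k <= l)%N -> x (s k) <= x (s l).
  elim: l => [|l IH]; first by rewrite leqn0 => /eqP->.
  by rewrite leq_eqVlt => /orP[/eqP->//|/IH/le_trans]; apply.
have jn2 : C2 + 1 <= N 0%N.
  rewrite /N s0; have /andP[_ /ltW] := truncn_itv (ltW (addr_gt0 C20 ltr01)).
  move/le_trans; apply; rewrite ler_nat; apply: leq_trans (j_ge_id _).
  by rewrite /n2 leq_max leqnn orbT.
have N00 : 0 < N 0%N by lra.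
have smon k : (n2 <= s k)%N.
  rewrite leqNgt -s0; apply/negP => /j_incr; rewrite -(ltr_nat R) => lt_s.
  have := xmon 0%N k isT; rewrite leNgt => /negP; apply.
  rewrite /x; case: (posnP (j (s k))) => [->|jk]; last by rewrite ltr_ln// posrE ltr0n.
  by rewrite ln0// ln_gt0//; apply: lt_le_trans jn2; lra.
have N0k k : N 0%N <= N k.
  rewrite /N ler_nat s0; have := smon k; rewrite leq_eqVlt => /orP[/eqP<-//|/j_incr].
  exact: ltnW.
have NC k : C2 + 1 <= N k by apply: le_trans (N0k k).
have Npos k : 0 < N k by have := NC k; lra.
have Nexp k : N k = expR (x (s k)) by rewrite /x lnK// posrE; apply: Npos.
have Nmon k l : (k <= l)%N -> N k <= N l by move=> kl; rewrite !Nexp ler_expR xmon.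
have xr : x (s r) <= theta * x (s 0%N).
  rewrite -rhor; suff : forall k, x (s k) <= rho ^+ k * x (s 0%N) by apply.
  elim=> [|k IH]; first by rewrite expr0 mul1r.
  have /andP[_ h] := Hs k; apply: le_trans h _; rewrite exprS -mulrA ler_pM2l//; lra.
(* C1 * Br bounds the variation of P over each of the selected windows. *)
pose Br := N r ^+ e * N r `^ c.
have Br0 : 0 < Br by rewrite mulr_gt0 ?exprn_gt0 ?powR_gt0.
have KBr : K * Br <= N 0%N ^+ e.+1.
  rewrite -(@lnK _ K) ?posrE// /Br /powR gt_eqF// -/(x (s r)) !Nexp -!expRM_natl -!expRD ler_expR.
  have : theta * x (s 0%N) * (e%:R + c) = (e%:R + (1 + c) / 2) * x (s 0%N).
    by rewrite /theta mulrAC divfK// gt_eqF.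
  have : x (s r) * (e%:R + c) <= theta * x (s 0%N) * (e%:R + c).
    by rewrite ler_pM2r//; lra.
  move: n2K; rewrite -s0 ler_pdivrMr; last lra.
  rewrite -(natr1 e); lra.
(* Slopes up to [bmax] keep b * P within 1/4 of its value at the start of each window; K was chosen
   so that a 0 * bmax >= 2Q nevertheless. *)
pose bmax := (4 * C1 * Br)^-1.
have CB0 : 0 < 4 * C1 * Br by apply: mulr_gt0 => //; apply: mulr_gt0.
pose a k := P.[(j (s k))%:Z].
have aE k : (a k)%:~R = p.[N k] by rewrite -pE.
have agro k : N k ^+ e.+1 / 2 <= (a k)%:~R <= C2 * N k ^+ e.+1.
  by rewrite aE; apply: gro; have := NC k; lra.
have apos : 0 < (a 0%N)%:~R :> R.
  have /andP[h _] := agro 0%N; apply: lt_le_trans h.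
  by rewrite divr_gt0// exprn_gt0.
have a0b : 2 * Q <= (a 0%N)%:~R * bmax.
  rewrite ler_pdivlMr//; have /andP[+ _] := agro 0%N; move: KBr; rewrite /K; lra.
have lac k : 8 * Q * (a k)%:~R <= (a k.+1)%:~R.
  have /andP[h1 _] := agro k.+1; have /andP[_ h2] := agro k.
  have NL : L * N k <= N k.+1.
    rewrite !Nexp -{1}(@lnK _ L) ?posrE; last lra.
    by rewrite -expRD ler_expR addrC; have /andP[] := Hs k.
  have : (L * N k) ^+ e.+1 <= N k.+1 ^+ e.+1.
    by rewrite lerXn2r// nnegrE ?mulr_ge0// ltW//; lra.
  rewrite exprMn => h3.
  have Nk : 0 < N k ^+ e.+1 by rewrite exprn_gt0.
  have h4 : L * N k ^+ e.+1 <= L ^+ e.+1 * N k ^+ e.+1.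
    by rewrite ler_pM2r// -{1}(expr1 L) ler_weXn2l// ltW.
  apply: le_trans h1; apply: (@le_trans _ _ (8 * Q * (C2 * N k ^+ e.+1))).
    by rewrite ler_pM2l//; lra.
  have : 16 * Q * C2 * N k ^+ e.+1 <= L * N k ^+ e.+1 by rewrite ler_pM2r// /L; lra.
  lra.
have [b [v [b0 bv vb _ Hb]]] :=
  nested_intervals (fun k => k%:R / 4) Q1 a0b apos lac r.
pose D k : set int := [set P.[(j (s k) + h)%:Z] | h in
  [set h | (1 <= h <= window c (j (s k)))%N]].
have HD k w : (k < 4 * q)%N -> D k w -> `|b * (w - a k)%:~R| <= 4^-1.
  move=> kr [h /= /andP[h1 hw] <-].
  have kr' : (k <= r)%N by apply: ltnW.
  have hc : h%:R <= N k `^ c.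
    apply: le_trans (_ : (window c (j (s k)))%:R <= _); first by rewrite ler_nat.
    by rewrite truncn_le powR_ge0.
  have N1 : 1 <= N k by have := NC k; lra.
  have hN : h%:R <= N k.
    by apply: le_trans hc _; rewrite -{2}(powRr1 (ltW (Npos k))) ler_powR// ltW.
  have incE : `|(P.[(j (s k) + h)%:Z] - a k)%:~R| <= C1 * N k ^+ e * h%:R.
    have := inc (N k) h%:R N1 (ler0n _ _) hN.
    by rewrite /N -natrD !pE rmorphB.
  rewrite normrM (ger0_norm b0).
  apply: (@le_trans _ _ (bmax * (C1 * Br))); last first.
    by rewrite /bmax -(mulrA 4) invfM mulfVK ?gt_eqF// mulr_gt0.
  apply: ler_pM => //; first lra.
  apply: le_trans incE _; rewrite -mulrA ler_pM2l// ler_pM ?exprn_ge0// ?(ltW (Npos _))//.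
    by rewrite lerXn2r ?nnegrE ?(ltW (Npos _))// Nmon.
  apply: le_trans hc _; apply: ge0_ler_powR; rewrite ?nnegrE ?(ltW (Npos _)) ?Nmon//.
  exact: ltW.
have Hl k : (k < 4 * q)%N -> exists l : int,
    k%:R / 4 + q%:R * l%:~R <= b * (a k)%:~R <= k%:R / 4 + q%:R * l%:~R + 4^-1.
  exact: Hb.
exists (\max_(k < r) s k)%N, b => z t tq.
have [k kr Hk] := nested_colouring q0 Hl HD z tq.
exists (s k); split.
- by apply: leq_trans (smon k); rewrite /n2 !leq_max leqnn.
- exact: (@leq_bigmax _ (fun k : 'I_r => s k) (Ordinal kr)).
- by move=> h hh; apply: Hk; exists h.
Unshelve. all: by end_near.
Qed.

(** For a negative leading coefficient, P, z and b all change sign, which leaves b * (z + P)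
    unchanged. *)
Lemma polynomial_colouring (R : realType) (j : nat -> nat) (P : {poly int}) (c : R)
    (q n0 : nat) :
    (forall m n : nat, (m < n)%N -> (j m < j n)%N) ->
    (ln ((j n.+1)%:R : R) / ln ((j n)%:R : R)) @[n --> \oo] --> (1 : R) ->
    (2 <= (size P).-1)%N -> 0 < c -> c < 1 -> (0 < q)%N ->
  exists (m : nat) (b : R), forall (z : int) s, (s < q)%N ->
    exists n, [/\ (n0 <= n)%N, (n <= m)%N & forall h, (1 <= h <= window c (j n))%N ->
      (Num.floor (b * (z + P.[(j n + h)%:Z])%:~R) %% q)%Z = s].
Proof.
move=> j_incr j_log degP c0 c1 q0.
have [lP|lP] := leP 1 (lead_coef P).
  exact: polynomial_colouring_pos.
have lP0 : lead_coef P != 0 by rewrite lead_coef_eq0 -size_poly_eq0; lia.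
have lNP : 1 <= lead_coef (- P).
  by rewrite lead_coefN; move: (lead_coef P) lP lP0 => l; lia.
have degNP : (2 <= (size (- P)).-1)%N by rewrite size_polyN.
have [m [b H]] := polynomial_colouring_pos n0 j_incr j_log degNP c0 c1 q0 lNP.
exists m, (- b) => z s sq; have [n [n0n nm Hn]] := H (- z) s sq.
exists n; split => // h hw; rewrite -(Hn h hw) hornerN -opprD.
by rewrite (rmorphN intr) mulrN mulNr.
Qed.

(** * Marker sets of aperiodic transformations *)

Section IntegerIterates.
Variables (X : Type) (T Tinv : X -> X).
Hypotheses (TK : cancel T Tinv) (TinvK : cancel Tinv T).

Lemma iterzS (z : int) x : iterz T Tinv (z + 1) x = T (iterz T Tinv z x).
Proof.
case: z => [n|[|n]]; first by rewrite -PoszD addn1.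
  by rewrite /= TinvK.
by rewrite (_ : Negz n.+1 + 1 = Negz n) ?NegzE; [rewrite /= TinvK|lia].
Qed.

Lemma iterzD (a b : int) x : iterz T Tinv (a + b) x = iterz T Tinv a (iterz T Tinv b x).
Proof.
elim: a => [|n IH|n IH]; first by rewrite add0r.
  by rewrite -addn1 PoszD addrAC iterzS IH -iterzS -PoszD addn1.
apply: (can_inj TK); rewrite -!iterzS.
have E : - n.+1%:Z + 1 = - n%:Z by lia.
by rewrite addrAC E IH.
Qed.

Lemma iterzK z : cancel (iterz T Tinv z) (iterz T Tinv (- z)).
Proof. by move=> x; rewrite -iterzD addNr. Qed.

End IntegerIterates.

Lemma probability_pigeonhole (R : realType) (d : measure_display) (X : measurableType d)
    (mu : probability X R) (L : nat) (F : 'I_L -> set X) : (0 < L)%N ->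
    (forall i, measurable (F i)) -> trivIset setT F ->
  exists i, (mu (F i) <= (L%:R^-1)%:E)%E.
Proof.
move=> L0 mF tr; apply/not_existsP => lt_mu.
have muE i : mu (F i) = (fine (mu (F i)))%:E by rewrite fineK// fin_num_measure.
have : (mu (\big[setU/set0]_(i < L) F i) <= 1)%E.
  by apply: probability_le1; apply: bigsetU_measurable.
rewrite (measure_bigsetU_ord mu xpredT mF tr) (eq_bigr _ (fun i _ => muE i)) sumEFin lee_fin.
apply/negP; rewrite -ltNge.
have -> : 1 = \sum_(i < L) (L%:R^-1 : R).
  by rewrite sumr_const card_ord -[RHS]mulr_natl divff// pnatr_eq0 -lt0n.
apply: ltr_sum => [|i _].
  by apply/hasP; exists (Ordinal L0); rewrite ?mem_index_enum.
by have /negP := lt_mu i; rewrite muE lee_fin -ltNge.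
Qed.

Section Dynamics.
Variables (R : realType) (d : measure_display) (X : measurableType d)
  (mu : probability X R) (T Tinv : X -> X).
Hypothesis T_imp : invertible_measure_preserving mu T Tinv.

Local Notation Tz := (iterz T Tinv).

Let TK : cancel T Tinv. Proof. by case: T_imp. Qed.
Let TinvK : cancel Tinv T. Proof. by case: T_imp. Qed.

Lemma measurable_preimage_iterz z (A : set X) :
  measurable A -> measurable (Tz z @^-1` A).
Proof.
have [_ _ mT mTinv _] := T_imp.
have miter (S : X -> X) : measurable_fun setT S -> forall n, measurable_fun setT (iter n S).
  by move=> mS; elim=> [|n IH]; [exact: measurable_id|exact: (measurableT_comp mS IH)].
move=> mA; rewrite -[_ @^-1` _]setTI.
by case: z => n; apply: miter.
Qed.

Lemma measure_preimage_iterz z (A : set X) :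
  measurable A -> mu (Tz z @^-1` A) = mu A.
Proof.
have [_ _ mT mTinv pT] := T_imp; move=> mA.
have step w : mu (Tz (w + 1) @^-1` A) = mu (Tz w @^-1` A).
  rewrite -(pT _ (measurable_preimage_iterz w mA)); congr (mu _).
  by apply/seteqP; split => x /=; rewrite (iterzD TK TinvK).
elim: z => // [n IH|n IH]; first by rewrite -addn1 PoszD step.
by rewrite -step (_ : - n.+1%:Z + 1 = - n%:Z)//; lia.
Qed.

Lemma negligible_preimage_iterz z (A : set X) :
  mu.-negligible A -> mu.-negligible (Tz z @^-1` A).
Proof.
move=> [B [mB B0 AB]]; exists (Tz z @^-1` B); split.
- exact: measurable_preimage_iterz.
- by rewrite measure_preimage_iterz.
- by move=> x /AB.
Qed.

(** The preimages of B under the first L iterates are pairwise disjoint and all have the measure of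
    B. *)
Lemma measure_le_inv_of_disjoint (L : nat) (B : set X) : (0 < L)%N -> measurable B ->
    (forall x i, (0 < i < L)%N -> B x -> ~ B (iter i T x)) ->
  (mu B <= (L%:R^-1)%:E)%E.
Proof.
move=> L0 mB dB.
have mF i : measurable (Tz (Posz i) @^-1` B) by apply: measurable_preimage_iterz.
have tr : trivIset [set: 'I_L] (fun i => Tz (Posz i) @^-1` B).
  apply/trivIsetP => i k _ _ ik; apply/seteqP; split => // x /= [].
  wlog lt_ik : i k ik / (i < k)%N => [W Bi Bk|Bi Bk].
    case: (ltngtP i k) => [h|h|/ord_inj/eqP]; last by rewrite (negbTE ik).
      exact: (W i k).
    by apply: (W k i) => //; rewrite eq_sym.
  apply: (dB _ (k - i)%N _ Bi); last by rewrite -iterD subnK// ltnW.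
  by rewrite subn_gt0 lt_ik/=; apply: leq_ltn_trans (leq_subr _ _) (ltn_ord k).
have [i] := probability_pigeonhole mu L0 (fun i : 'I_L => mF i) tr.
by rewrite (measure_preimage_iterz (Posz i)).
Qed.

End Dynamics.

(** The sets A k are pulled back from a countable base of Y. A finite set is closed in a Hausdorff
    space, so some basic neighbourhood of f x avoids all the points f (y i) at once. *)
Lemma countable_separation (R : realType) (d : measure_display) (X : measurableType d)
    (mu : probability X R) : standard_probability mu ->
  exists (X0 : set X) (A : nat -> set X),
    [/\ measurable X0, mu (~` X0) = 0%E, forall k, measurable (A k) &
      forall x (n : nat) (y : nat -> X), X0 x ->
        (forall i, (i < n)%N -> X0 (y i) /\ y i <> x) ->
        exists2 k, A k x & forall i, (i < n)%N -> ~ A k (y i)].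
Proof.
move=> [Y [X0 [f [[hY [D /countable_injP[g ginj] [Dopen Dbase]]] [mX0 muX0] [finj _] mf _]]]].
(* By injectivity of g this is the basic set with code k, or empty if k codes none. *)
pose O k := \bigcup_(U in [set U | D U /\ g U = k]) U.
have openO k : open (O k) by apply: bigcup_open => U [] /Dopen.
exists X0, (fun k => X0 `&` f @^-1` O k); split => //.
  by move=> k; apply: mf; apply: sub_sigma_algebra.
move=> x n y X0x Hy.
pose S := ~` ((f \o y) @` `I_n).
have oS : open S.
  rewrite openC; apply: (accessible_finite_set_closed.1 (hausdorff_accessible hY)).
  exact/finite_image/finite_II.
have Sfx : S (f x).
  move=> [i /= ilt fyx]; have [X0y yx] := Hy i ilt.
  by apply: yx; apply: finj fyx; rewrite inE.
have [U [DU Ux] US] := Dbase (f x) _ (open_nbhs_nbhs (conj oS Sfx)).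
have OE : O (g U) = U.
  apply/seteqP; split => [z [V [DV gV] Vz]|z Uz]; last by exists U.
  by rewrite -(ginj V U) ?inE.
exists (g U); first by rewrite /= OE.
by move=> i ilt [_]; rewrite /= OE => /US; apply; exists i.
Qed.

Section MarkerSet.
Variables (R : realType) (d : measure_display) (X : measurableType d)
  (mu : probability X R) (T Tinv : X -> X).
Hypothesis T_imp : invertible_measure_preserving mu T Tinv.

Local Notation Tz := (iterz T Tinv).

Let TK : cancel T Tinv. Proof. by case: T_imp. Qed.
Let TinvK : cancel Tinv T. Proof. by case: T_imp. Qed.

(* [C k] consists of the points of a basic set [A k] whose next [L - 1] iterates avoid [A k]:
   separating the distinct points x, T x, ..., T^(L-1) x by some [A k] shows that they cover. *)
Lemma disjoint_cover_aperiodic (L : nat) : standard_probability mu -> aperiodic mu T ->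
  exists C : nat -> set X, [/\ forall k, measurable (C k),
    forall k x i, (0 < i < L)%N -> C k x -> ~ C k (iter i T x) &
    mu.-negligible (~` (\bigcup_k C k))].
Proof.
move=> /countable_separation[X0 [A [mX0 muX0 mA sepA]]] aper.
exists (fun k => A k `&` \bigcap_(i in [set i | (0 < i < L)%N]) ~` (Tz (Posz i) @^-1` A k)).
split.
- move=> k; apply: measurableI => //; apply: bigcap_measurableType => i _.
  by apply: measurableC; apply: (measurable_preimage_iterz T_imp).
- move=> k x i iL [_ /(_ i iL) nA] [/nA].
  by [].
- have nX0 : mu.-negligible (~` X0).
    by exists (~` X0); split => //; apply: measurableC.
  have nI : mu.-negligible (\bigcup_i (Tz (Posz i) @^-1` (~` X0))).
    by apply: negligible_bigcup => i; apply: (negligible_preimage_iterz T_imp).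
  apply: negligibleS (negligibleU nI aper) => x /= nC.
  apply: contrapT => /not_orP[good per]; apply: nC.
  have X0i i : X0 (iter i T x).
    by apply: contrapT => nX0i; apply: good; exists i.
  have [|k Ax Ak] := sepA x L.-1 (fun i => iter i.+1 T x) (X0i 0%N).
    by move=> i _; split => // xi; apply: per; exists i.+1.
  exists k => //; split => // -[//|i] /= iL.
  by apply: Ak; rewrite -ltnS prednK//; case: (L) iL.
Qed.

(* On each orbit, [B] is the trace of the first [C k] met by this orbit. As the index [k] depends
   only on the orbit, [B] inherits the disjointness of its translates from [C k]. *)
Lemma marker_set (L : nat) : (0 < L)%N -> standard_probability mu -> aperiodic mu T ->
  exists B : set X, [/\ measurable B, (mu B <= (L%:R^-1)%:E)%E &
    mu.-negligible [set x | forall z, ~ B (Tz z x)]].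
Proof.
move=> L0 std aper; have [C [mC dC nC]] := disjoint_cover_aperiodic L std aper.
pose Sat k := [set x | exists z, C k (Tz z x)].
have SatT k z x : Sat k (Tz z x) -> Sat k x.
  by move=> [w Cw]; exists (w + z); rewrite (iterzD TK TinvK).
have mSat k : measurable (Sat k).
  rewrite (_ : Sat k = \bigcup_z (Tz z @^-1` C k)).
    apply: countable_bigcupT_measurable => // z.
    exact: (measurable_preimage_iterz T_imp).
  by apply/seteqP; split => x [z]; [exists z|move=> _ ?; exists z].
pose B := \bigcup_k (C k `\` \bigcup_(i in `I_k) Sat i).
have mB : measurable B.
  apply: bigcupT_measurable => k; apply: measurableD => //.
  by apply: bigcup_measurable => i _.
exists B; split => //.
  apply: (measure_le_inv_of_disjoint T_imp L0 mB) => x i iL [k _ [Ckx nk]] [l _ [Cl nl]].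
  have [kl|lk|kl] := ltngtP k l.
  - by apply: nl; exists k => //; exists (- Posz i); rewrite -[iter i T x]/(Tz (Posz i) x) iterzK.
  - by apply: nk; exists l => //; exists (Posz i).
  - by apply: (dC k x i iL Ckx); rewrite kl.
apply: negligibleS nC => x /= nB; apply: contrapT => /contrapT[k0 _ Ck0].
have exk : exists k, `[< Sat k x >] by exists k0; apply/asboolP; exists 0.
case: (ex_minnP exk) => k /asboolP[z Cz] kmin.
apply: (nB z); exists k => //; split => // -[i /= ik /SatT Si].
have := kmin i; rewrite leqNgt ik => /(_ _)/negP; apply => //.
exact/asboolP.
Qed.

End MarkerSet.

(** * Small sets that sweep out *)

(* Sweeping out for the shift on the integers: the level sets of [color] play the role of the
   small sets. *)
Definition sweeping_samples (W : nat -> seq int) : Prop :=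
  forall q n0 : nat, (0 < q)%N -> exists (m : nat) (color : int -> int),
    forall (z : int) (s : nat), (s < q)%N -> exists n : nat,
      [/\ (n0 <= n)%N, (n <= m)%N & forall w, w \in W n -> color (z + w) = s].

Section FirstHit.
Variables (R : realType) (d : measure_display) (X : measurableType d)
  (mu : probability X R) (T Tinv : X -> X).
Hypothesis T_imp : invertible_measure_preserving mu T Tinv.

Local Notation Tz := (iterz T Tinv).

Let TK : cancel T Tinv. Proof. by case: T_imp. Qed.
Let TinvK : cancel Tinv T. Proof. by case: T_imp. Qed.

Definition first_hit (B : set X) (n : nat) : set X :=
  (Tz (Posz n) @^-1` B) `&` \bigcap_(i in `I_n) ~` (Tz (Posz i) @^-1` B).

Lemma measurable_first_hit B n : measurable B -> measurable (first_hit B n).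
Proof.
move=> mB; apply: measurableI; first exact: (measurable_preimage_iterz T_imp).
apply: bigcap_measurableType => i _; apply: measurableC.
exact: (measurable_preimage_iterz T_imp).
Qed.

Lemma first_hit_inj B n m x : first_hit B n x -> first_hit B m x -> n = m.
Proof.
move=> [Bn nBn] [Bm nBm]; have [nm|mn|//] := ltngtP n m.
  by have /= := nBm n nm.
by have /= := nBn m mn.
Qed.

(** Minus the hitting time advances by w, as a translation of the integers would: times i + w in
    [-M, M] miss B by hypothesis, and those beyond M are positive times before n. *)
Lemma first_hit_shift B n x (M : nat) (w : int) : first_hit B n x ->
    (forall i : int, `|i| <= M -> ~ B (Tz i x)) -> `|w| <= M ->
  exists2 k : nat, k%:Z = n%:Z - w & first_hit B k (Tz w x).
Proof.
move=> [/= Bn nBn] nBM wM.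
have nM : (M < n)%N.
  by rewrite ltnNge; apply/negP => nM; apply: (nBM (Posz n) _ Bn).
have kE : `|n%:Z - w|%N%:Z = n%:Z - w by lia.
exists `|n%:Z - w|%N => //; split.
  by rewrite /= -[iter _ _ _]/(Tz `|n%:Z - w|%N%:Z _) -(iterzD TK TinvK) kE subrK.
move=> i /= ik; rewrite -[iter _ _ _]/(Tz i%:Z _) -(iterzD TK TinvK).
case: (lerP `|i%:Z + w| M) => [|iwM]; first exact: nBM.
have iwE : i%:Z + w = absz (i%:Z + w) by lia.
by rewrite iwE; apply: nBn => /=; lia.
Qed.

(* Poincare recurrence: the set of points that never enter [B] is mapped into itself by [T],
   hence is almost invariant, so that almost all its orbits miss [B] altogether. *)
Lemma negligible_no_hit B : measurable B ->
    mu.-negligible [set x | forall z, ~ B (Tz z x)] ->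
  mu.-negligible (~` \bigcup_n first_hit B n).
Proof.
move=> mB nB.
pose N := \bigcap_(i : nat) ~` (Tz (Posz i) @^-1` B).
have mN : measurable N.
  by apply: bigcapT_measurable => i; apply: measurableC; apply: (measurable_preimage_iterz T_imp).
have nN : mu.-negligible (\bigcup_k (N `\` Tz (- Posz k) @^-1` N)).
  apply: negligible_bigcup => k.
  have mNk : measurable (Tz (- Posz k) @^-1` N) by apply: (measurable_preimage_iterz T_imp).
  have sub : Tz (- Posz k) @^-1` N `<=` N.
    move=> x /= Nx i _ /=; have /= := Nx (i + k)%N I.
    by rewrite -!/(Tz (Posz _) _) -(iterzD TK TinvK) PoszD addrK.
  apply/negligibleP; first exact: measurableD.
  rewrite measureD// ?(ltey_eq, fin_num_measure)// setIidr//.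
  rewrite [X in (_ - X)%E](measure_preimage_iterz T_imp (- Posz k) mN).
  by rewrite subee// fin_num_measure.
apply: negligibleS (negligibleU nN nB) => x /= nhit.
have Nx : N x.
  move=> i _ Bi; apply: nhit.
  have ex : exists k, `[< B (Tz (Posz k) x) >] by exists i; apply/asboolP.
  case: (ex_minnP ex) => k /asboolP Bk kmin; exists k => //; split => // l /= lk Bl.
  by have := kmin l (asboolT Bl); rewrite leqNgt lk.
have [hit|] := pselect (exists z, B (Tz z x)); last first.
  by move=> nex; right => z Bz; apply: nex; exists z.
(* The visit lies at a negative time -(k+1), so x is in N while its preimage at that time is not. *)
left; have [[k|k] Bz] := hit; first by have := Nx k I.
by exists k.+1 => //; split => // Nk; have := Nk 0%N I; apply.
Qed.

End FirstHit.

Section Sweeping.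
Variables (R : realType) (d : measure_display) (X : measurableType d)
  (mu : probability X R) (T Tinv : X -> X).
Hypothesis T_imp : invertible_measure_preserving mu T Tinv.

Local Notation Tz := (iterz T Tinv).

Lemma small_sweeping_set (W : nat -> seq int) :
    standard_probability mu -> aperiodic mu T -> sweeping_samples W ->
  forall (eps : R) (n0 : nat), 0 < eps -> exists (m : nat) (F Bad : set X),
    [/\ measurable F, measurable Bad, (mu F <= eps%:E)%E, (mu Bad <= eps%:E)%E &
      forall x, ~ Bad x -> exists n, [/\ (n0 <= n)%N, (n <= m)%N &
        forall w, w \in W n -> F (Tz w x)]].
Proof.
move=> std aper sw eps n0 eps0.
pose q := (Num.truncn eps^-1).+1.
have qeps : ((q%:R^-1)%:E <= eps%:E)%E.
  rewrite lee_fin -[eps]invrK lef_pV2 ?posrE ?invr_gt0 ?ltr0n//.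
  by have /andP[_ /ltW] := truncn_itv (ltW (etrans (invr_gt0 eps) eps0) : 0 <= eps^-1).
have [m [color Hcolor]] := sw q n0 isT.
(* A bound for all sampling times that can occur up to index m. *)
pose M := (\max_(n < m.+1) \max_(w <- W n) absz w)%N.
have WM n w : (n <= m)%N -> w \in W n -> `|w| <= M.
  move=> nm wn; rewrite -abszE lez_nat.
  apply: (@leq_trans (\max_(w <- W n) absz w)).
    exact: (leq_bigmax_seq (F := absz)).
  have nm' : (n < m.+1)%N by [].
  exact: (@leq_bigmax _ (fun n : 'I_m.+1 => \max_(w <- W n) absz w)%N (Ordinal nm')).
(* The points that meet B within time M form 2M + 1 translates of B, of total measure at most (2M +
   1)/L = 1/q. *)
pose L := ((2 * M).+1 * q)%N.
have [B [mB muB nB]] := marker_set T_imp (isT : (0 < L)%N) std aper.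
pose F (s : 'I_q) := \bigcup_(n in [set n : nat | color (- n%:Z) = s]) first_hit T Tinv B n.
have mF s : measurable (F s).
  by apply: bigcup_measurable => n _; apply: (measurable_first_hit T_imp).
have trF : trivIset setT F.
  apply/trivIsetP => s t _ _ st; apply/seteqP; split => // x [[n /= ns hn] [k /= kt hk]].
  move: kt; rewrite -(first_hit_inj hn hk) ns => -[/val_inj] E.
  by rewrite E eqxx in st.
(* Any colour s would sweep; the pigeonhole provides one whose level set is small. *)
have [s muFs] := probability_pigeonhole mu (isT : (0 < q)%N) mF trF.
have [N [mN muN subN]] := negligible_no_hit T_imp mB nB.
pose near_B := \bigcup_(i < (2 * M).+1) (Tz (i%:Z - M%:Z) @^-1` B).
have mnear : measurable near_B.
  by apply: bigcup_measurable => i _; apply: (measurable_preimage_iterz T_imp).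
exists m, (F s), (near_B `|` N); split => //.
- exact: measurableU.
- exact: le_trans muFs qeps.
- apply: (le_trans (measureU2 mu mnear mN)); rewrite [X in (_ + X)%E]muN adde0.
  apply: (le_trans _ qeps).
  have mi (i : nat) : measurable (Tz (i%:Z - M%:Z) @^-1` B).
    exact: (measurable_preimage_iterz T_imp).
  rewrite /near_B bigcup_mkord.
  apply: le_trans (@le_mu_bigsetU _ _ _ mu (fun i : nat => Tz (i%:Z - M%:Z) @^-1` B) _ _) _.
    by move=> i _; apply: mi.
  apply: (@le_trans _ _ (\sum_(i < (2 * M).+1) (L%:R^-1)%:E)%E).
    apply: lee_sum => i _.
    by rewrite [X in (X <= _)%E](measure_preimage_iterz T_imp (i%:Z - M%:Z) mB).
  rewrite sumEFin lee_fin sumr_const card_ord -[X in X <= _]mulr_natr.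
  by rewrite /L natrM invfM mulrAC mulVf ?mul1r// pnatr_eq0.
- move=> x /not_orP[nnear nNx].
  have [n _ hn] : (\bigcup_n first_hit T Tinv B n) x.
    by apply: contrapT => /subN.
  have nBM (i : int) : `|i| <= M -> ~ B (Tz i x).
    move=> iM Bi; apply: nnear.
    exists (absz (i + M%:Z)) => /=; first lia.
    by rewrite (_ : (absz (i + M%:Z))%:Z - M%:Z = i)//; lia.
  have [k [n0k km Hk]] := Hcolor (- n%:Z) s (ltn_ord s).
  exists k; split => // w wk.
  have [l lE hl] := first_hit_shift T_imp hn nBM (WM k w km wk).
  by exists l => //=; rewrite lE opprB addrC Hk.
Qed.

End Sweeping.

(** * Alternating small sets *)

(** The cost c (e k) k is known only once e k is fixed, so e is built recursively. The last bound
    makes the tail sum of 2^(- e) after k at most 2^(- (e k + c (e k) k)). *)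
Lemma fast_decaying_sequence (c : nat -> nat -> nat) (e0 : nat) :
  exists e : nat -> nat, [/\ e 0%N = e0, forall k, (e0 + k <= e k)%N &
    forall k i, (e k + c (e k) k + i.+1 <= e (k + i.+1))%N].
Proof.
pose e := fix e k := if k is k'.+1 then (e k' + c (e k') k' + 1)%N else e0.
exists e; have eS k : e k.+1 = (e k + c (e k) k + 1)%N by [].
have e_le k i : (e k + i <= e (k + i))%N.
  by elim: i => [|i IH]; rewrite ?addn0// !addnS eS; lia.
split=> // [k|k i]; first exact: (e_le 0%N).
by have := e_le k.+1 i; rewrite (addSnnS k i) eS; lia.
Qed.

Lemma natr_le_exp2 (R : realFieldType) (n : nat) : n%:R * 2 ^- n <= 1 :> R.
Proof.
by rewrite -[2 ^- n]div1r mulrA mulr1 ler_pdivrMr ?exprn_gt0// mul1r -natrX ler_nat ltnW// ltn_expl.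
Qed.

Section Gluing.
Variables (R : realType) (d : measure_display) (X : measurableType d)
  (mu : probability X R) (T Tinv : X -> X).
Hypothesis T_imp : invertible_measure_preserving mu T Tinv.

Local Notation Tz := (iterz T Tinv).

Lemma measure_bigcup_half (F : nat -> set X) (eps : R) : 0 <= eps ->
    (forall i, measurable (F i)) -> (forall i, (mu (F i) <= (eps / (2 ^ i.+1)%:R)%:E)%E) ->
  (mu (\bigcup_i F i) <= eps%:E)%E.
Proof.
move=> eps0 mF muF.
apply: (le_trans (@measure_sigma_subadditive _ _ _ mu _ F mF _ (@subset_refl _ _))).
  exact: bigcupT_measurable.
apply: le_trans (epsilon_trick0 xpredT eps0).
by apply: lee_nneseries => // i _; apply: muF.
Qed.

Lemma alternating_set (W : nat -> seq int) :
    (forall n, W n != [::]) ->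
    (forall (eps : R) (n0 : nat), 0 < eps -> exists (m : nat) (F Bad : set X),
      [/\ measurable F, measurable Bad, (mu F <= eps%:E)%E, (mu Bad <= eps%:E)%E &
        forall x, ~ Bad x -> exists n, [/\ (n0 <= n)%N, (n <= m)%N &
          forall w, w \in W n -> F (Tz w x)]]) ->
  forall delta : R, 0 < delta -> exists E : set X,
    [/\ measurable E, (0 < mu E)%E, (mu E < delta%:E)%E &
      {ae mu, forall x,
        (forall N, exists2 n, (N <= n)%N & forall w, w \in W n -> E (Tz w x)) /\
        (forall N, exists2 n, (N <= n)%N & forall w, w \in W n -> ~ E (Tz w x))}].
Proof.
move=> W0 sweep delta delta0.
(* Sets are chosen for all pairs of a precision e and a starting index k, so that the precisions can
   be fixed afterwards. *)
have /choice[f Hf] : forall ek : nat * nat, exists t : nat * set X * set X,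
    [/\ measurable t.1.2, measurable t.2, (mu t.1.2 <= (2 ^- ek.1)%:E)%E,
      (mu t.2 <= (2 ^- ek.1)%:E)%E &
      forall x, ~ t.2 x -> exists n, [/\ (ek.2 <= n)%N, (n <= t.1.1)%N &
          forall w, w \in W n -> t.1.2 (Tz w x)]].
  move=> [e k]; have [|m [F [Bad H]]] := sweep (2 ^- e) k.
    by rewrite invr_gt0 exprn_gt0.
  by exists (m, F, Bad).
pose Ws m := flatten [seq W n | n <- iota 0 m.+1].
(* Large enough for 2 * 2^(- e0) < delta, where 2 * 2^(- e0) bounds the total measure of the sets F
   k. *)
pose e0 := (Num.truncn (2 / delta)).+1.
have [e [e00 ek e_c]] := fast_decaying_sequence (fun e k => size (Ws (f (e, k)).1.1)) e0.
pose F k := (f (e k, k)).1.2.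
pose Bad k := (f (e k, k)).2.
pose V k := Ws (f (e k, k)).1.1.
have mF k : measurable (F k) by have [] := Hf (e k, k).
have mBad k : measurable (Bad k) by have [] := Hf (e k, k).
have muF k : (mu (F k) <= (2 ^- e k)%:E)%E by have [] := Hf (e k, k).
have muBad k : (mu (Bad k) <= (2 ^- e k)%:E)%E by have [] := Hf (e k, k).
pose U k := \bigcup_i F (k + i.+1)%N.
have mU k : measurable (U k) by apply: bigcupT_measurable.
have two_le (a b : nat) : (a <= b)%N -> 2 ^- b <= 2 ^- a :> R.
  by move=> ab; rewrite lef_pV2 ?posrE ?exprn_gt0// ler_weXn2l// ler1n.
have muU k : (mu (U k) <= (2 ^- (e k + size (V k)))%:E)%E.
  apply: measure_bigcup_half => // i.
  by apply: le_trans (muF _) _; rewrite lee_fin natrX -invfM -exprD two_le.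
(* The second part collects the points that a sampling time of stage k carries into a later F. These
   are size (V k) translates of U k, and the factor 2^(- size (V k)) in the measure of U k pays for
   their number. *)
pose Bad' k := Bad k `|` \bigcup_(i < size (V k)) (Tz (nth 0 (V k) i) @^-1` U k).
have mBadU k : measurable (\bigcup_(i < size (V k)) (Tz (nth 0 (V k) i) @^-1` U k)).
  by apply: bigcup_measurable => i _; apply: (measurable_preimage_iterz T_imp).
have mBad' k : measurable (Bad' k) by apply: measurableU.
have muBad' k : (mu (Bad' k) <= (4 / (2 ^ k.+1)%:R)%:E)%E.
  apply: (le_trans (measureU2 mu (mBad k) (mBadU k))).
  apply: (@le_trans _ _ ((2 ^- k)%:E + (2 ^- k)%:E)%E); last first.
    by rewrite -EFinD lee_fin natrX exprS invfM mulrA; lra.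
  have ekk : 2 ^- e k <= 2 ^- k :> R.
    by apply: two_le; apply: leq_trans (ek k); exact: leq_addl.
  apply: leeD; first by apply: le_trans (muBad k) _; rewrite lee_fin.
  rewrite bigcup_mkord.
  apply: (le_trans (@le_mu_bigsetU _ _ _ mu (fun i => Tz (nth 0 (V k) i) @^-1` U k) _ _)).
    by move=> i _; apply: (measurable_preimage_iterz T_imp).
  apply: (@le_trans _ _ (\sum_(i < size (V k)) (2 ^- (e k + size (V k)))%:E)%E).
    apply: lee_sum => i _.
    by rewrite [X in (X <= _)%E](measure_preimage_iterz T_imp (nth 0 (V k) i) (mU k)).
  rewrite sumEFin lee_fin sumr_const card_ord -[X in X <= _]mulr_natl exprD invfM mulrCA.
  by apply: le_trans ekk; rewrite -[leRHS]mulr1 ler_wpM2l ?natr_le_exp2.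
(* Borel-Cantelli: almost every point is bad for finitely many stages only. *)
have muLim : mu (lim_sup_set Bad') = 0.
  apply: lim_sup_set_cvg0 => //.
  apply: le_lt_trans (_ : (4%:E < +oo)%E); last exact: ltry.
  apply: le_trans (epsilon_trick0 xpredT (ler0n R 4)).
  by apply: lee_nneseries => // i _; apply: muBad'.
have good x : ~ lim_sup_set Bad' x -> exists k0, forall k, (k0 <= k)%N ->
    exists2 n, (k <= n)%N & forall w, w \in W n -> (F k `\` U k) (Tz w x).
  move=> nlim; have [k0 Hk0] : exists k0, forall k, (k0 <= k)%N -> ~ Bad' k x.
    apply: contrapT => nk0; apply: nlim => k0 _; apply: contrapT => nB; apply: nk0.
    by exists k0 => k k0k Bk; apply: nB; exists k.
  exists k0 => k /Hk0 /not_orP[nBad nU].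
  have [_ _ _ _ /(_ x nBad)[n [kn nm HF]]] := Hf (e k, k).
  exists n => // w wn; split; first exact: HF.
  have wV : w \in V k.
    apply/flattenP; exists (W n) => //; apply/mapP; exists n => //.
    by rewrite mem_iota add0n ltnS.
  by move=> Uw; apply: nU; exists (index w (V k)); rewrite /= ?index_mem// nth_index.
(* F k minus U k consists of the points whose last membership has index k, so an odd last index
   excludes a point from E. *)
pose E := \bigcup_k (F k.*2 `\` U k.*2).
have mE : measurable E by apply: bigcupT_measurable => k; apply: measurableD.
have nE k y : (F k.*2.+1 `\` U k.*2.+1) y -> ~ E y.
  move=> [Fy Uy] [l _ [Fl Ul]]; case: (ltngtP k.*2.+1 l.*2) => kl; last by lia.
    by apply: Uy; exists (l.*2 - k.*2.+2)%N => //; rewrite (_ : (_ + _)%N = l.*2)//; lia.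
  by apply: Ul; exists (k.*2.+1 - l.*2.+1)%N => //; rewrite (_ : (_ + _)%N = k.*2.+1)//; lia.
have aeE : {ae mu, forall x,
    (forall N, exists2 n, (N <= n)%N & forall w, w \in W n -> E (Tz w x)) /\
    (forall N, exists2 n, (N <= n)%N & forall w, w \in W n -> ~ E (Tz w x))}.
  exists (lim_sup_set Bad'); split => //.
    by apply: bigcap_measurableType => k _; apply: bigcup_measurable.
  move=> x /= nx; apply: contrapT => /good[k0 Hk0]; apply: nx; split => N.
    have [n kn Hn] := Hk0 (k0 + N).*2 ltac:(lia).
    by exists n; [lia|move=> w /Hn Fw; exists (k0 + N)%N].
  have [n kn Hn] := Hk0 (k0 + N).*2.+1 ltac:(lia).
  by exists n; [lia|move=> w /Hn /nE].
exists E; split => //.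
(* Almost every point has a window inside E, and windows are nonempty; if E were null, countably
   many null translates of E would cover almost all of X. *)
- rewrite lt0e measure_ge0 andbT; apply/eqP => muE.
  have nEE : mu.-negligible (\bigcup_n (Tz (head 0 (W n)) @^-1` E)).
    apply: negligible_bigcup => n; apply: (negligible_preimage_iterz T_imp).
    by apply/negligibleP.
  have /measure_negligible : mu.-negligible [set: X].
    apply: negligibleS (negligibleU aeE nEE) => x _.
    have [h|] := pselect ((\bigcup_n (Tz (head 0 (W n)) @^-1` E)) x); first by right.
    move=> nx; left => -[/(_ 0%N)[n _ Hn] _]; apply: nx; exists n => //; apply: Hn.
    by case: (W n) (W0 n) => //= w s _; rewrite mem_head.
  move=> /(_ measurableT); rewrite [X in X = _]probability_setT => /eqP.
  by rewrite onee_eq0.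
- apply: (@le_lt_trans _ _ (2 * 2 ^- e0)%:E).
    apply: (@le_trans _ _ (mu (\bigcup_k F k))).
      apply: le_measure; rewrite ?inE//; first exact: bigcupT_measurable.
      by move=> x [k _ [Fk _]]; exists k.*2.
    apply: measure_bigcup_half => // k.
    apply: (le_trans (muF k)); rewrite lee_fin natrX exprS invfM mulrACA divff ?pnatr_eq0//.
    by rewrite mul1r -invfM -exprD two_le.
  rewrite lte_fin ltr_pdivrMr ?exprn_gt0// -ltr_pdivrMl// mulrC.
  have /andP[_ lt_e0] := truncn_itv (ltW (divr_gt0 (ltr0Sn R 1) delta0)).
  by apply: lt_le_trans lt_e0 _; rewrite -natrX ler_nat ltnW// ltn_expl.
Qed.

End Gluing.

(** * Averages of indicators and conclusion *)

Lemma limn_esup_max (R : realType) (u : nat -> \bar R) (l : \bar R) :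
  (forall n, (u n <= l)%E) -> (forall N, exists2 n, (N <= n)%N & u n = l) ->
  limn_esup u = l.
Proof.
move=> ul ex; rewrite limn_esup_lim.
rewrite (_ : esups u = fun=> l) ?lim_cst//; apply/funext => N.
apply/eqP; rewrite eq_le; apply/andP; split.
  by apply: ub_ereal_sup => _ [n _ <-].
by apply: ereal_sup_ubound; have [n Nn <-] := ex N; exists n.
Qed.

Lemma limn_einf_min (R : realType) (u : nat -> \bar R) (l : \bar R) :
  (forall n, (l <= u n)%E) -> (forall N, exists2 n, (N <= n)%N & u n = l) ->
  limn_einf u = l.
Proof.
move=> lu ex; rewrite -[u](_ : -%E \o (-%E \o u) = u).
  rewrite limn_einfN (@limn_esup_max _ _ (- l)%E) ?oppeK// => [n|N].
    by rewrite /= leeN2.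
  by have [n Nn un] := ex N; exists n; rewrite //= un.
by apply/funext => n /=; rewrite oppeK.
Qed.

Lemma average_indic_itv (R : realType) (X : Type) (E : set X) (w : nat) (y : nat -> X) :
  0 <= (w%:R^-1 : R) * \sum_(1 <= h < w.+1) \1_E (y h) <= 1.
Proof.
rewrite mulr_ge0 ?invr_ge0 ?sumr_ge0//=.
(* For w = 0 the convention that the inverse of 0 is 0 makes the average 0. *)
have [->|w0] := posnP w; first by rewrite invr0 mul0r.
rewrite ler_pdivrMl ?ltr0n// mulr1.
apply: (@le_trans _ _ (\sum_(1 <= h < w.+1) 1)); last first.
  by rewrite sumr_const_nat subSS subn0.
by apply: ler_sum => h _; rewrite indicE; case: (_ \in _).
Qed.

Theorem theorem3 (R : realType) (j : nat -> nat) (P : {poly int}) (c : R)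
    (j_gt0 : forall n : nat, (0 < j n)%N)
    (j_incr : forall m n : nat, (m < n)%N -> (j m < j n)%N)
    (j_infty : j n @[n --> \oo] --> \oo)
    (j_log : (ln ((j n.+1)%:R : R) / ln ((j n)%:R : R)) @[n --> \oo] --> (1 : R))
    (degP : (2 <= (size P).-1)%N)
    (c_gt0 : 0 < c) (c_lt1 : c < 1)
    (d : measure_display) (X : measurableType d) (mu : probability X R)
    (mu_standard : standard_probability mu) (mu_non_atomic : non_atomic mu)
    (T Tinv : X -> X)
    (T_imp : invertible_measure_preserving mu T Tinv)
    (T_aperiodic : aperiodic mu T) :
  strong_sweeping_out mu (fun n : nat => poly_average T Tinv P c (j n)).
Proof.
(* As j n >= 1, its power with exponent c is at least 1. *)
have window_gt0 n : (0 < window c (j n))%N.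
  rewrite truncn_gt0 -[leLHS](powRr0 ((j n)%:R : R)) ler_powR ?(ltW c_gt0)//.
  by rewrite ler1n.
pose W n := [seq P.[(j n + h)%:Z] | h <- iota 1 (window c (j n))].
have WP n h : (1 <= h <= window c (j n))%N -> P.[(j n + h)%:Z] \in W n.
  by move=> hw; apply/mapP; exists h => //; rewrite mem_iota add1n ltnS.
have W0 n : W n != [::] by rewrite -size_eq0 size_map size_iota -lt0n.
have sweepW : sweeping_samples W.
  move=> q n0 q0.
  have [m [b Hb]] := polynomial_colouring n0 j_incr j_log degP c_gt0 c_lt1 q0.
  exists m, (fun z => (Num.floor (b * z%:~R) %% q)%Z) => z s sq.
  have [n [n0n nm Hn]] := Hb z s sq; exists n; split => // w /mapP[h].
  by rewrite mem_iota add1n ltnS => hw ->; apply: Hn.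
move=> delta delta0.
have [E [mE E0 Edelta aeE]] := alternating_set T_imp W0
  (small_sweeping_set T_imp mu_standard T_aperiodic sweepW) delta0.
have avgE n x a : (forall w, w \in W n -> \1_E (iterz T Tinv w x) = a :> R) ->
    poly_average T Tinv P c (j n) \1_E x = a.
  move=> Ha; rewrite /poly_average (eq_big_nat _ _ (F2 := fun=> a)).
    rewrite sumr_const_nat subSS subn0 -[X in _ * X]mulr_natl mulKf// pnatr_eq0 -lt0n.
    exact: window_gt0.
  by move=> h hw; apply: Ha; apply: WP; rewrite -ltnS.
have avg01 n x : 0 <= poly_average T Tinv P c (j n) (\1_E : X -> R) x <= 1.
  exact: average_indic_itv.
(* The averages lie in [0, 1] and equal 1 or 0 exactly on windows inside or outside E; both kinds
   recur for arbitrarily large n. *)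
exists E; split => //; apply: filterS aeE => x [sup_x inf_x].
- apply: limn_esup_max => [n|N]; first by rewrite lee_fin; have /andP[] := avg01 n x.
  have [n Nn Hn] := sup_x N; exists n => //; rewrite (avgE n x 1)// => w wn.
  by rewrite indicE mem_set//; apply: Hn.
- apply: limn_einf_min => [n|N]; first by rewrite lee_fin; have /andP[] := avg01 n x.
  have [n Nn Hn] := inf_x N; exists n => //; rewrite (avgE n x 0)// => w wn.
  by rewrite indicE memNset//; apply: Hn.
Qed.
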